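(* Suppose $\widetilde U$ and $\widehat U$ are ordered upper and lower solutions (nondecreasing case) of the scheme (NDS), and suppose that for every $m\ge1$, every $p\in\overline\Omega^h$, every $\alpha\neq\alpha'$ in $\{1,2\}$ and every $u\in\mathbb R^2$ with $\widehat U(p,t_m)\le u\le\widetilde U(p,t_m)$, $$\frac{\partial f_\alpha(p,t_m,u)}{\partial u_\alpha}\le c_\alpha(p,t_m),\qquad -\frac{\partial f_\alpha(p,t_m,u)}{\partial u_{\alpha'}}\ge0,$$ where $c_\alpha$ are nonnegative bounded functions. Then there exists a solution $U$ of (NDS) with $\widehat U(p,t_m)\le U(p,t_m)\le\widetilde U(p,t_m)$ for all $p\in\overline\Omega^h$ and all $m\ge1$.
   Context: Data: $l_1,l_2,T>0$, $\omega=(0,l_1)\times(0,l_2)$, $Q_T=\omega\times(0,T]$, $\partial Q_T=\partial\omega\times(0,T]$; for $\alpha=1,2$: constants $\varepsilon_\alpha>0$, smooth functions $f_\alpha(x,y,t,u)$, $u=(u_1,u_2)$, $g_\alpha$ on $\partial Q_T$, $\psi_\alpha$ on $\overline\omega$, and smooth nonnegative $v_{\alpha,1},v_{\alpha,2}$ on $\overline Q_T$. Vector inequalities are componentwise. Mesh: $x_i=ih_x$ ($0\le i\le N_x$, $h_x=l_1/N_x$), $y_j=jh_y$ ($0\le j\le N_y$, $h_y=l_2/N_y$), $t_m=m\tau$ ($0\le m\le N_\tau$, $\tau=T/N_\tau$). $\overline\Omega^h$ is the set of all $p=(x_i,y_j)$, $\Omega^h$ the interior ones, $\partial\Omega^h=\overline\Omega^h\setminus\Omega^h$.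 ''$m\ge1$'' means $1\le m\le N_\tau$. Operator: $\mathcal L^h_\alpha U_\alpha=-\varepsilon_\alpha(D_x^2U_\alpha+D_y^2U_\alpha)+v_{\alpha,1}D_x^1U_\alpha+v_{\alpha,2}D_y^1U_\alpha$, with $D_x^2,D_y^2$ the standard second central differences and $D_x^1,D_y^1$ the backward differences. Scheme (NDS): for $\alpha=1,2$, $m\ge1$, $(\mathcal L^h_\alpha(p,t_m)+\tau^{-1})U_\alpha(p,t_m)+f_\alpha(p,t_m,U)-\tau^{-1}U_\alpha(p,t_{m-1})=0$ for $p\in\Omega^h$; $U(p,t_m)=g(p,t_m)$ for $p\in\partial\Omega^h$; $U(p,0)=\psi(p)$ for $p\in\overline\Omega^h$. Ordered upper and lower solutions (nondecreasing case): $\widetilde U,\widehat U$ are such if, for all $m\ge1$ and $\alpha=1,2$: $\widetilde U\ge\widehat U$ on $\overline\Omega^h$; on $\Omega^h$, $(\mathcal L^h_\alpha+\tau^{-1})\widetilde U_\alpha(p,t_m)+f_\alpha(p,t_m,\widetilde U)-\tau^{-1}\widetilde U_\alpha(p,t_{m-1})\ge0$ and $(\mathcal L^h_\alpha+\tau^{-1})\widehat U_\alpha(p,t_m)+f_\alpha(p,t_m,\widehat U)-\tau^{-1}\widehat U_\alpha(p,t_{m-1})\le0$; $\widehat U\le g\le\widetilde U$ on $\partial\Omega^h$; and $\widehat U(p,0)\le\psi(p)\le\widetilde U(p,0)$ on $\overline\Omega^h$. *)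

(* Defs.v *)
From HB Require Import structures.
From mathcomp Require Import all_boot all_order all_algebra.
From mathcomp Require Import all_classical all_reals all_analysis.

Set Implicit Arguments.
Unset Strict Implicit.
Unset Printing Implicit Defensive.

Import Order.TTheory GRing.Theory Num.Theory.
Import numFieldNormedType.Exports.

Local Open Scope classical_set_scope.
Local Open Scope ring_scope.

(* F is of class C^k on the open set U.  Only used for finite-dimensional V,
   where quantifying over all directions v amounts to quantifying over the
   coordinate directions. *)
Fixpoint Ck (R : realType) (V : normedModType R) (k : nat) (U : set V)
    (F : V -> R) : Prop :=
  match k with
  | 0%N => forall z, U z -> {for z, continuous F}
  | k'.+1 => (forall z, U z -> differentiable F z) /\
             (forall v : V, Ck k' U (fun z => 'D_v F z))
  end.

(* Smoothness on a set A that need not be open: F has, around each point of A,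
   a local C^oo extension.  The values of F outside A are irrelevant. *)
Definition smooth_on (R : realType) (V : normedModType R) (A : set V)
    (F : V -> R) : Prop :=
  forall a, A a -> exists (U : set V) (G : V -> R),
    [/\ open U, U a, forall k, Ck k U G & forall z, A z -> U z -> G z = F z].

Section Domains.
Context {R : realType}.
Variables l1 l2 T : R.

Definition omega : set (R * R) := `]0, l1[ `*` `]0, l2[.
Definition omega_bar : set (R * R) := `[0, l1] `*` `[0, l2].
Definition bd_omega : set (R * R) := omega_bar `\` omega.
Definition QT_bar : set (R * R * R) := omega_bar `*` `[0, T].
Definition bd_QT : set (R * R * R) := bd_omega `*` `]0, T].

End Domains.

(* Space-time points are triples ((x, y), t); the species index alpha ranges
   over 'I_2, and u = (u_1, u_2) is a row vector.  The data are total functions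
   whose values outside the sets named in the axioms are irrelevant. *)
Record problem (R : realType) := Problem {
  l1 : R;
  l2 : R;
  T : R;
  eps : 'I_2 -> R;
  v1 : 'I_2 -> R * R * R -> R;
  v2 : 'I_2 -> R * R * R -> R;
  f : 'I_2 -> R * R * R -> 'rV[R]_2 -> R;
  g : 'I_2 -> R * R * R -> R;
  psi : 'I_2 -> R * R -> R;
  l1_gt0 : 0 < l1;
  l2_gt0 : 0 < l2;
  T_gt0 : 0 < T;
  eps_gt0 : forall a, 0 < eps a;
  v1_smooth : forall a, smooth_on (QT_bar l1 l2 T) (v1 a);
  v2_smooth : forall a, smooth_on (QT_bar l1 l2 T) (v2 a);
  v1_ge0 : forall a z, QT_bar l1 l2 T z -> 0 <= v1 a z;
  v2_ge0 : forall a z, QT_bar l1 l2 T z -> 0 <= v2 a z;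
  f_smooth : forall a,
    smooth_on (QT_bar l1 l2 T `*` [set: 'rV[R]_2])
      (fun zu : (R * R * R) * 'rV[R]_2 => f a zu.1 zu.2);
  g_smooth : forall a, smooth_on (bd_QT l1 l2 T) (g a);
  psi_smooth : forall a, smooth_on (omega_bar l1 l2) (psi a)
}.

Record mesh := Mesh {
  Nx : nat;
  Ny : nat;
  Nt : nat;
  Nx_gt0 : (0 < Nx)%N;
  Ny_gt0 : (0 < Ny)%N;
  Nt_gt0 : (0 < Nt)%N
}.

Definition vle (R : realType) (u w : 'rV[R]_2) : Prop :=
  forall a : 'I_2, u 0 a <= w 0 a.

Section Scheme.
Context {R : realType}.
Variables (P : problem R) (M : mesh).

Definition hx : R := l1 P / (Nx M)%:R.
Definition hy : R := l2 P / (Ny M)%:R.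
Definition tau : R := T P / (Nt M)%:R.

Definition node (i j : nat) : R * R := (i%:R * hx, j%:R * hy).
Definition time (m : nat) : R := m%:R * tau.

(* Mesh nodes are handled through their indices (i, j). *)
Definition closed_node (i j : nat) : bool := (i <= Nx M)%N && (j <= Ny M)%N.
Definition inner_node (i j : nat) : bool :=
  (0 < i < Nx M)%N && (0 < j < Ny M)%N.
Definition bd_node (i j : nat) : bool := closed_node i j && ~~ inner_node i j.
Definition step (m : nat) : bool := (1 <= m <= Nt M)%N.

(* A mesh function takes the value U i j m at ((x_i, y_j), t_m); its values at
   indices beyond Nx, Ny, Nt are never used. *)
Definition mesh_fun := nat -> nat -> nat -> 'rV[R]_2.

Definition D2x (w : nat -> nat -> R) (i j : nat) : R :=
  (w i.+1 j - 2 * w i j + w i.-1 j) / hx ^+ 2.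
Definition D2y (w : nat -> nat -> R) (i j : nat) : R :=
  (w i j.+1 - 2 * w i j + w i j.-1) / hy ^+ 2.
Definition D1x (w : nat -> nat -> R) (i j : nat) : R :=
  (w i j - w i.-1 j) / hx.
Definition D1y (w : nat -> nat -> R) (i j : nat) : R :=
  (w i j - w i j.-1) / hy.

Definition Lh (a : 'I_2) (m : nat) (w : nat -> nat -> R) (i j : nat) : R :=
  - eps P a * (D2x w i j + D2y w i j)
  + v1 P a (node i j, time m) * D1x w i j
  + v2 P a (node i j, time m) * D1y w i j.

Definition residual (U : mesh_fun) (a : 'I_2) (i j m : nat) : R :=
  Lh a m (fun i' j' => U i' j' m 0 a) i j + tau^-1 * U i j m 0 a
  + f P a (node i j, time m) (U i j m)
  - tau^-1 * U i j m.-1 0 a.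

Definition NDS_solution (U : mesh_fun) : Prop :=
  [/\ forall a i j m, step m -> inner_node i j -> residual U a i j m = 0,
      forall a i j m, step m -> bd_node i j ->
        U i j m 0 a = g P a (node i j, time m)
    & forall a i j, closed_node i j -> U i j 0%N 0 a = psi P a (node i j)].

Definition ordered_upper_lower (Ut Uh : mesh_fun) : Prop :=
  [/\ forall i j m, step m -> closed_node i j -> vle (Uh i j m) (Ut i j m),
      forall a i j m, step m -> inner_node i j -> 0 <= residual Ut a i j m,
      forall a i j m, step m -> inner_node i j -> residual Uh a i j m <= 0,
      forall a i j m, step m -> bd_node i j ->
        Uh i j m 0 a <= g P a (node i j, time m) <= Ut i j m 0 a
    & forall a i j, closed_node i j ->
        Uh i j 0%N 0 a <= psi P a (node i j) <= Ut i j 0%N 0 a].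

Definition df_du (a b : 'I_2) (z : R * R * R) (u : 'rV[R]_2) : R :=
  'D_(delta_mx 0 b) (f P a z) u.

End Scheme.

(* Main.v *)
Require Import Defs.
From mathcomp Require Import all_boot all_order all_algebra.
From mathcomp Require Import all_classical all_reals all_analysis.
From mathcomp Require Import ring lra.
Set Implicit Arguments.
Unset Strict Implicit.
Import Order.TTheory GRing.Theory Num.Theory.
Import numFieldNormedType.Exports.
Local Open Scope ring_scope.

(** The theorem is an instance of the Knaster-Tarski principle, applied once on
    the whole space-time mesh.  At an inner node the scheme reads

      d U_a(p, t_m) + f_a(p, t_m, U) = (combination of the other values of U_a),

    where the other values are those at the four neighbours of [p] and at [p]
    at the previous time.  Because the diffusion is centred, the convection is
    differenced backwards and the velocities are nonnegative, the combination
    on the right has nonnegative coefficients ([le_inflow]).  Adding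
    [c_a U_a] to both sides makes the equation a fixed-point equation
    [U = G U], where [G] is monotone between the lower and the upper solution:
    the hypotheses on the derivatives of [f] say exactly that
    [u |-> c_a u_a - f_a u] is nondecreasing there ([le_reaction]).  The
    boundary and initial data enter [G] as constants.

    The sign conditions on the residuals say that the lower solution is below
    its image under [G] and the upper solution above ([le_jacobi], [ge_jacobi]),
    so [G] has a fixed point between them ([tarski_between]), namely the
    pointwise supremum of the functions [u] with [u <= G u].  Such a fixed point
    solves the scheme.  No compactness or continuity of [G], and no solution of
    linear systems, is involved. *)

(** * Fixed points of monotone maps between functions *)

(** The set [D] lets the order and the fixed-point equation concern a part of
    the index set only, as mesh functions carry irrelevant values off the
    mesh. *)
Lemma tarski_between (R : realType) (I : Type) (D : I -> Prop)
    (G : (I -> R) -> I -> R) (lo hi : I -> R) :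
  let between u := forall i, D i -> lo i <= u i <= hi i in
  (forall i, D i -> lo i <= hi i) ->
  (forall u w, between u -> between w -> (forall i, D i -> u i <= w i) ->
    forall i, D i -> G u i <= G w i) ->
  (forall i, D i -> lo i <= G lo i) ->
  (forall i, D i -> G hi i <= hi i) ->
  exists2 u, between u & forall i, D i -> G u i = u i.
Proof.
move=> between lohi Gmono loG Ghi.
pose S u := between u /\ forall i, D i -> u i <= G u i.
pose A i : set R := fun x => exists2 u, S u & x = u i.
pose U i := sup (A i).
have blo : between lo by move=> i Di; rewrite lexx lohi.
have bhi : between hi by move=> i Di; rewrite lexx lohi.
have Slo : S lo by [].
have leU u i : S u -> D i -> u i <= U i.
  move=> Su Di; apply: ub_le_sup; last by exists u.
  by exists (hi i) => _ [w [bw _] ->]; have /andP[] := bw i Di.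
have Ule i x : (forall u, S u -> u i <= x) -> U i <= x.
  move=> ux; apply: ge_sup; first by exists (lo i), lo.
  by move=> _ [w Sw ->]; exact: ux.
have bU : between U.
  move=> i Di; rewrite leU //=; apply: Ule => u [bu _].
  by have /andP[] := bu i Di.
have UG i : D i -> U i <= G U i.
  move=> Di; apply: Ule => u Su; have [bu uG] := Su.
  by apply: le_trans (uG i Di) _; apply: Gmono => // k Dk; exact: leU.
have bGU : between (G U).
  move=> i Di; apply/andP; split.
    apply: le_trans (loG i Di) _; apply: Gmono => // k Dk.
    by have /andP[] := bU k Dk.
  apply: le_trans (Ghi i Di); apply: Gmono => // k Dk.
  by have /andP[] := bU k Dk.
exists U => // i Di; apply/eqP; rewrite eq_le UG // andbT.
by apply: leU => //; split => // k Dk; exact: Gmono.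
Qed.

(** * Monotonicity from signs of partial derivatives *)

Lemma is_derive_line (R : realType) (V : normedModType R) (h : V -> R)
    (u v : V) (s : R) : derivable h (u + s *: v) v ->
  is_derive s 1 (fun s => h (u + s *: v)) ('D_v h (u + s *: v)).
Proof.
have E : (fun k : R => k^-1 *: (h (k *: v + (u + s *: v)) - h (u + s *: v)))
    = (fun k => k^-1 *: (h (u + (k *: (1 : R) + s) *: v) - h (u + s *: v))).
  by apply/funext => k; rewrite [k *: 1]mulr1 scalerDl addrCA.
by rewrite /derive /derivable E => dh; apply: DeriveDef.
Qed.

(** [F] agrees with its smooth local extension only where the first argument
    lies in [A], which may have boundary points; but the second argument ranges
    over the full space, so at a fixed [z] in [A] the agreement holds on a
    neighbourhood of each [u]. *)
Lemma smooth_section (R : realType) (V W : normedModType R) (A : set V)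
    (F : V -> W -> R) (z : V) :
  smooth_on (A `*` [set: W])%classic (fun zu => F zu.1 zu.2) -> A z ->
  forall u, exists2 g : W -> R, differentiable g u &
    \forall u' \near u, g u' = F z u'.
Proof.
move=> FA Az u; have [|U [H [oU Uzu /(_ 1%N) [dH _] HF]]] := FA (z, u).
  by split.
have dpair : differentiable (fun u' : W => (z, u')) u.
  by apply: (@differentiable_pair _ _ _ _ (cst z) id).
exists (fun u' => H (z, u')).
  by apply: differentiable_comp => //; exact: dH.
have nU : nbhs (z, u) U by exact: open_nbhs_nbhs.
have nearU : \forall u' \near u, U (z, u').
  exact: (differentiable_continuous dpair) nU.
by apply: filterS nearU => u' Uu'; apply: HF.
Qed.

Lemma derive_row_sum (R : realType) (n : nat) (h : 'rV[R]_n.+1 -> R)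
    (u v : 'rV[R]_n.+1) :
  (exists2 g : 'rV[R]_n.+1 -> R, differentiable g u &
    \forall u' \near u, g u' = h u') ->
  derivable h u v /\ 'D_v h u = \sum_b v 0 b * 'D_(delta_mx 0 b) h u.
Proof.
move=> [g dg gh]; split.
  exact: near_eq_derivable gh (diff_derivable dg).
rewrite -(near_eq_derive _ gh) deriveE // {1}[v]row_sum_delta linear_sum.
apply: eq_bigr => b _.
by rewrite -(near_eq_derive _ gh) deriveE // linearZ.
Qed.

(** The mean value theorem along the segment from [u] to [w], which stays in
    the box. *)
Lemma le_reaction (R : realType) (h : 'rV[R]_2 -> R) (lo hi : 'rV[R]_2)
    (a : 'I_2) (c : R) (u w : 'rV[R]_2) :
  (forall x, exists2 g : 'rV[R]_2 -> R, differentiable g x &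
    \forall x' \near x, g x' = h x') ->
  (forall x, vle lo x -> vle x hi -> 'D_(delta_mx 0 a) h x <= c) ->
  (forall x b, b != a -> vle lo x -> vle x hi ->
    'D_(delta_mx 0 b) h x <= 0) ->
  vle lo u -> vle w hi -> vle u w ->
  c * u 0 a - h u <= c * w 0 a - h w.
Proof.
move=> hloc ha hb lou whi uw; pose v := w - u.
have v_ge0 b : 0 <= v 0 b by rewrite !mxE subr_ge0.
have dline (s : R) :
    is_derive s 1 (fun s : R => h (u + s *: v)) ('D_v h (u + s *: v)).
  by apply: is_derive_line; have [] := derive_row_sum v (hloc (u + s *: v)).
have [|s] := @MVT_segment R (fun s => h (u + s *: v))
  (fun s => 'D_v h (u + s *: v)) 0 1 ler01 (fun s _ => dline s).
  apply: derivable_within_continuous => s _; exact: ex_derive.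
rewrite in_itv /= => /andP[s0 s1].
rewrite scale0r addr0 scale1r subr0 mulr1 /v addrCA subrr addr0 -/v => hwu.
set x := u + s *: v in hwu.
have lox : vle lo x.
  move=> b; apply: le_trans (lou b) _.
  by rewrite /x mxE lerDl mxE mulr_ge0.
have xhi : vle x hi.
  move=> b; apply: le_trans (whi b).
  have -> : w 0 b = u 0 b + v 0 b by rewrite !mxE; ring.
  by rewrite /x mxE lerD2l mxE ler_piMl.
suff : h w - h u <= c * (w 0 a - u 0 a) by lra.
rewrite hwu; have [_ ->] := derive_row_sum v (hloc x).
rewrite (bigD1 a) //= -[leRHS]addr0 lerD //.
  have -> : w 0 a - u 0 a = v 0 a by rewrite !mxE.
  by rewrite mulrC ler_wpM2r // ha.
by apply: sumr_le0 => b ba; rewrite mulr_ge0_le0 // hb.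
Qed.

(** * The scheme as a fixed-point equation *)

Section Jacobi.
Context {R : realType}.
Variables (P : problem R) (M : mesh).

Let hx_gt0 : 0 < hx P M.
Proof. by rewrite divr_gt0 ?l1_gt0 // ltr0n Nx_gt0. Qed.

Let hy_gt0 : 0 < hy P M.
Proof. by rewrite divr_gt0 ?l2_gt0 // ltr0n Ny_gt0. Qed.

Let tau_gt0 : 0 < tau P M.
Proof. by rewrite divr_gt0 ?T_gt0 // ltr0n Nt_gt0. Qed.

Let mesh_coord (L : R) (N k : nat) :
  0 < L -> (0 < N)%N -> (k <= N)%N -> 0 <= k%:R * (L / N%:R) <= L.
Proof.
move=> L0 N0 kN; have N0' : 0 < N%:R :> R by rewrite ltr0n.
apply/andP; split; first by rewrite mulr_ge0 ?divr_ge0 // ltW.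
rewrite mulrCA ger_pMr //.
by rewrite ler_pdivrMr // mul1r ler_nat.
Qed.

Lemma node_QT_bar i j m : closed_node M i j -> step M m ->
  QT_bar (l1 P) (l2 P) (T P) (node P M i j, time P M m).
Proof.
move=> /andP[iN jN] /andP[_ mN]; split; first split; rewrite /= in_itv /=.
- exact: mesh_coord (l1_gt0 P) (Nx_gt0 M) iN.
- exact: mesh_coord (l2_gt0 P) (Ny_gt0 M) jN.
- exact: mesh_coord (T_gt0 P) (Nt_gt0 M) mN.
Qed.

Lemma inner_closed i j : inner_node M i j ->
  [/\ closed_node M i j, closed_node M i.+1 j, closed_node M i.-1 j,
      closed_node M i j.+1 & closed_node M i j.-1].
Proof.
move=> /andP[/andP[i0 iN] /andP[j0 jN]]; rewrite /closed_node.
by rewrite !(ltnW iN, ltnW jN, iN, jN, leq_trans (leq_pred _) (ltnW _)).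
Qed.

Definition diagonal (a : 'I_2) (i j m : nat) : R :=
  2 * eps P a / hx P M ^+ 2 + 2 * eps P a / hy P M ^+ 2
  + v1 P a (node P M i j, time P M m) / hx P M
  + v2 P a (node P M i j, time P M m) / hy P M + (tau P M)^-1.

Definition inflow (U : @mesh_fun R) (a : 'I_2) (i j m : nat) : R :=
  eps P a / hx P M ^+ 2 * (U i.+1 j m 0 a + U i.-1 j m 0 a)
  + eps P a / hy P M ^+ 2 * (U i j.+1 m 0 a + U i j.-1 m 0 a)
  + v1 P a (node P M i j, time P M m) / hx P M * U i.-1 j m 0 a
  + v2 P a (node P M i j, time P M m) / hy P M * U i j.-1 m 0 a
  + (tau P M)^-1 * U i j m.-1 0 a.

Lemma residualE U a i j m : residual P M U a i j m =
  diagonal a i j m * U i j m 0 a + f P a (node P M i j, time P M m) (U i j m)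
  - inflow U a i j m.
Proof.
rewrite /residual /Lh /D2x /D2y /D1x /D1y /diagonal /inflow.
by field; rewrite !gt_eqF.
Qed.

Lemma diagonal_gt0 a i j m : step M m -> inner_node M i j ->
  0 < diagonal a i j m.
Proof.
move=> sm /inner_closed[cij _ _ _ _]; have Q := node_QT_bar cij sm.
have e0 := ltW (eps_gt0 P a); have x0 := ltW hx_gt0; have y0 := ltW hy_gt0.
by rewrite ltr_wpDl ?invr_gt0 // !addr_ge0 // divr_ge0 ?v1_ge0 ?v2_ge0
  ?exprn_ge0 // mulr_ge0.
Qed.

Lemma le_inflow (U W : @mesh_fun R) a i j m :
  step M m -> inner_node M i j ->
  (forall i' j' m', closed_node M i' j' -> (m' <= Nt M)%N ->
    U i' j' m' 0 a <= W i' j' m' 0 a) ->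
  inflow U a i j m <= inflow W a i j m.
Proof.
move=> sm /inner_closed[cij c1 c2 c3 c4] UW; have Q := node_QT_bar cij sm.
have mN : (m <= Nt M)%N by case/andP: sm.
have m'N : (m.-1 <= Nt M)%N := leq_trans (leq_pred m) mN.
have e0 := ltW (eps_gt0 P a); have x0 := ltW hx_gt0; have y0 := ltW hy_gt0.
have t0 := ltW tau_gt0.
by rewrite !lerD // ler_wpM2l ?lerD ?UW ?invr_ge0 // divr_ge0 ?exprn_ge0
  ?v1_ge0 ?v2_ge0.
Qed.

(** Values of mesh functions, indexed by a single type so that the general
    fixed-point lemma applies: node, time level, component. *)
Definition mesh_index : Type := (nat * nat * nat * 'I_2)%type.

Definition on_mesh (k : mesh_index) : Prop :=
  let: (i, j, m, _) := k in closed_node M i j /\ (m <= Nt M)%N.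

Definition values (U : @mesh_fun R) (k : mesh_index) : R :=
  let: (i, j, m, a) := k in U i j m 0 a.

Definition of_values (u : mesh_index -> R) : @mesh_fun R :=
  fun i j m => \row_a u (i, j, m, a).

Lemma valuesK : cancel values of_values.
Proof.
move=> U; apply/funext => i; apply/funext => j; apply/funext => m.
by apply/rowP => a; rewrite mxE.
Qed.

Variable c : 'I_2 -> nat -> nat -> nat -> R.

(** One Jacobi sweep for the equation with [c U] added on both sides.  All
    values are replaced simultaneously, at every time level. *)
Definition jacobi (u : mesh_index -> R) (k : mesh_index) : R :=
  let: (i, j, m, a) := k in
  if m == 0%N then psi P a (node P M i j)
  else if inner_node M i j then
    u k - residual P M (of_values u) a i j m
          / (diagonal a i j m + c a i j m)
  else g P a (node P M i j, time P M m).

Hypothesis c_ge0 : forall a i j m, step M m -> closed_node M i j ->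
  0 <= c a i j m.

Let weight_gt0 a i j m : step M m -> inner_node M i j ->
  0 < diagonal a i j m + c a i j m.
Proof.
move=> sm Iij; have [cij _ _ _ _] := inner_closed Iij.
by rewrite ltr_wpDr ?diagonal_gt0 // c_ge0.
Qed.

Lemma jacobi_fixed u :
  (forall k, on_mesh k -> jacobi u k = u k) ->
  NDS_solution P M (of_values u).
Proof.
move=> fixu; split.
- move=> a i j m sm Iij; have [cij _ _ _ _] := inner_closed Iij.
  have /andP[m0 mN] := sm.
  have := fixu (i, j, m, a) (conj cij mN); rewrite /= gtn_eqF // Iij.
  move/eqP; rewrite -subr_eq0 addrAC subrr add0r oppr_eq0 mulf_eq0 invr_eq0.
  by rewrite (gt_eqF (weight_gt0 _ sm Iij)) orbF => /eqP.
- move=> a i j m /andP[m0 mN] /andP[cij nI]; rewrite mxE.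
  by have := fixu (i, j, m, a) (conj cij mN); rewrite /= gtn_eqF // ifN.
- by move=> a i j cij; rewrite mxE -(fixu (i, j, 0%N, a)).
Qed.

Variables Ut Uh : @mesh_fun R.
Hypothesis hUL : ordered_upper_lower P M Ut Uh.

Lemma le_jacobi k : on_mesh k -> values Uh k <= jacobi (values Uh) k.
Proof.
have [_ _ hres hbd hinit] := hUL; case: k => [[[i j] m] a] [cij mN] /=.
case: posnP => [->|m0]; first by have /andP[] := hinit a i j cij.
have sm : step M m by rewrite /step m0.
case: ifPn => [Iij|nI].
  by rewrite valuesK lerBrDr gerDl mulr_le0_ge0 ?hres ?invr_ge0 ?ltW ?weight_gt0.
by have /andP[] := hbd a i j m sm (introT andP (conj cij nI)).
Qed.

Lemma ge_jacobi k : on_mesh k -> jacobi (values Ut) k <= values Ut k.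
Proof.
have [_ tres _ hbd hinit] := hUL; case: k => [[[i j] m] a] [cij mN] /=.
case: posnP => [->|m0]; first by have /andP[] := hinit a i j cij.
have sm : step M m by rewrite /step m0.
case: ifPn => [Iij|nI].
  by rewrite valuesK gerBl divr_ge0 ?tres ?ltW ?weight_gt0.
by have /andP[] := hbd a i j m sm (introT andP (conj cij nI)).
Qed.

Lemma le_lower_upper k : on_mesh k -> values Uh k <= values Ut k.
Proof.
have [hle _ _ _ hinit] := hUL; case: k => [[[i j] m] a] [cij mN] /=.
case: (posnP m) => [->|m0]; last by apply: hle => //; rewrite /step m0.
(* the ordering at the initial level is not assumed: it passes through psi *)
by have /andP[] := hinit a i j cij; exact: le_trans.
Qed.

Hypothesis hf : forall (a a' : 'I_2) i j m (u : 'rV[R]_2),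
  a != a' -> step M m -> closed_node M i j ->
  vle (Uh i j m) u -> vle u (Ut i j m) ->
  df_du P a a (node P M i j, time P M m) u <= c a i j m /\
  0 <= - df_du P a a' (node P M i j, time P M m) u.

Lemma jacobi_homo u w :
  (forall k, on_mesh k -> values Uh k <= u k <= values Ut k) ->
  (forall k, on_mesh k -> values Uh k <= w k <= values Ut k) ->
  (forall k, on_mesh k -> u k <= w k) ->
  forall k, on_mesh k -> jacobi u k <= jacobi w k.
Proof.
move=> bu bw uw [[[i j] m] a] [cij mN] /=.
case: posnP => // m0; case: ifPn => // Iij.
have sm : step M m by rewrite /step m0.
have K0 := weight_gt0 a sm Iij.
have fmono : c a i j m * u (i, j, m, a)
      - f P a (node P M i j, time P M m) (of_values u i j m)
    <= c a i j m * w (i, j, m, a)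
      - f P a (node P M i j, time P M m) (of_values w i j m).
  have := @le_reaction R (f P a (node P M i j, time P M m)) (Uh i j m)
    (Ut i j m) a (c a i j m) (of_values u i j m) (of_values w i j m).
  rewrite !mxE; apply.
  - apply: smooth_section (node_QT_bar cij sm); exact: f_smooth.
  - move=> x lox xhi.
    have [b ab] : exists b : 'I_2, a != b.
      by exists (lift a ord0); exact: neq_lift.
    by have [] := hf ab sm cij lox xhi.
  - move=> x b; rewrite eq_sym => ab lox xhi; rewrite -oppr_ge0.
    by have [] := hf ab sm cij lox xhi.
  - by move=> b; rewrite mxE; have /andP[] := bu (i, j, m, b) (conj cij mN).
  - by move=> b; rewrite mxE; have /andP[] := bw (i, j, m, b) (conj cij mN).
  - by move=> b; rewrite !mxE; exact: uw.
have flow : inflow (of_values u) a i j m <= inflow (of_values w) a i j m.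
  by apply: le_inflow => // i' j' m' c' m'N; rewrite !mxE; exact: uw.
have jacE x : x (i, j, m, a) - residual P M (of_values x) a i j m
      / (diagonal a i j m + c a i j m)
    = (inflow (of_values x) a i j m + (c a i j m * x (i, j, m, a)
      - f P a (node P M i j, time P M m) (of_values x i j m)))
      / (diagonal a i j m + c a i j m).
  by rewrite residualE mxE; field; rewrite gt_eqF.
by rewrite !jacE ler_wpM2r ?invr_ge0 ?(ltW K0) // lerD.
Qed.

End Jacobi.

Unset Implicit Arguments.
Set Strict Implicit.

Theorem theorem3 (R : realType) (P : problem R) (M : mesh)
    (Ut Uh : @mesh_fun R) (c : 'I_2 -> nat -> nat -> nat -> R)
    (hUL : ordered_upper_lower P M Ut Uh)
    (c_ge0 : forall a i j m, step M m -> closed_node M i j -> 0 <= c a i j m)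
    (c_bounded : exists K : R, forall a i j m,
       step M m -> closed_node M i j -> c a i j m <= K)
    (hf : forall (a a' : 'I_2) i j m (u : 'rV[R]_2),
       a != a' -> step M m -> closed_node M i j ->
       vle (Uh i j m) u -> vle u (Ut i j m) ->
       df_du P a a (node P M i j, time P M m) u <= c a i j m /\
       0 <= - df_du P a a' (node P M i j, time P M m) u) :
  exists U : @mesh_fun R,
    NDS_solution P M U /\
    forall i j m, step M m -> closed_node M i j ->
      vle (Uh i j m) (U i j m) /\ vle (U i j m) (Ut i j m).
Proof.
have [u bu fixu] := tarski_between (le_lower_upper hUL)
  (jacobi_homo c_ge0 hf) (le_jacobi c_ge0 hUL) (ge_jacobi c_ge0 hUL).
exists (of_values u); split; first exact (jacobi_fixed c_ge0 fixu).
move=> i j m /andP[_ mN] cij.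
by split=> a; rewrite mxE; have /andP[] := bu (i, j, m, a) (conj cij mN).
Qed.
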